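(* There exist an absolute constant $c>0$ and an integer $n_0$ such that for every integer $n\ge n_0$, every positive integer $k$ with $k\le \exp\!\left(c\frac{n}{\log n}\right)$ belongs to $\mathrm{LE}(n)$; that is, for each such $k$ there is a poset $P$ with exactly $n$ elements and $\mathrm{ext}(P)=k$.
   Context: All posets are finite. For a finite poset $P$, $\mathrm{ext}(P)$ denotes the number of linear extensions of $P$ (total orders on the ground set of $P$ that extend the partial order). For a positive integer $n$, $\mathrm{LE}(n)=\{\mathrm{ext}(P): P \text{ a poset with } |P|=n\}$. Logarithms are natural. *)

(* Defs.v *)
From mathcomp Require Import all_boot.
Set Implicit Arguments. Unset Strict Implicit. Unset Printing Implicit Defensive.

Definition is_poset (n : nat) (R : rel 'I_n) : bool :=
  [&& [forall x, R x x],
      [forall x, forall y, (R x y && R y x) ==> (x == y)] &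
      [forall x, forall y, forall z, (R x y && R y z) ==> R x z]].

Definition is_linear_order (n : nat) (L : rel 'I_n) : bool :=
  is_poset L && [forall x, forall y, L x y || L y x].

Definition ext (n : nat) (R : rel 'I_n) : nat :=
  #|[set L : {set 'I_n * 'I_n} |
      is_linear_order (fun x y => (x, y) \in L) &&
      [forall x, forall y, R x y ==> ((x, y) \in L)]]|.

(* Main.v *)
(** Adding to a poset P, with a distinguished maximal element w, a new element
    above everything but w turns (x, y) = (ext P, ext (P - w)) into (x + y, y)
    or (x + y, x), according to which of the two maximal elements is then
    distinguished; adding a new top element resets the pair to (x, x).
    Running the Euclidean algorithm on (k, m) backwards, a poset with
    gcd(k, m) linear extensions is thus extended to one with k linear extensions,
    at a cost of one element per unit of the sum of the partial quotients of k / m.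

    A partial quotient at least j at a convergent of denominator q forces m q to
    be congruent modulo k to some nonzero r with q j |r| <= k, and for given q
    and j at most 2 k / (q j) residues m do this.  Hence all but a small
    proportion of the residues m have all partial quotients O(log k), with sum
    O(log k log log k).  As gcd(k, m) <= 2 sqrt k for at least three quarters of
    the m, the same construction applies recursively to gcd(k, m), and the total
    number of elements is O(log k log log k). *)

From Stdlib Require Import Reals Lra.
From mathcomp Require Import all_boot zify.
Require Import Defs.
Set Implicit Arguments. Unset Strict Implicit. Unset Printing Implicit Defensive.

(** * Counting linear extensions *)

Section LinearExtensionsOn.
Variables (T : finType) (R : rel T).
Implicit Types (A : {set T}) (L : {set T * T}).

(* Linear orders on A are sets of pairs contained in A x A, so that the linear
   extensions of all subposets live in one type. *)
Definition linext A : {set {set T * T}} := [set L : {set T * T} |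
  [&& L \subset setX A A,
      [forall x in A, forall y in A, ((x, y) \in L) || ((y, x) \in L)],
      [forall x, forall y, ((x, y) \in L) && ((y, x) \in L) ==> (x == y)],
      [forall x, forall y, forall z,
         ((x, y) \in L) && ((y, z) \in L) ==> ((x, z) \in L)] &
      [forall x in A, forall y in A, R x y ==> ((x, y) \in L)]]].

Lemma linextP A L : reflect
  [/\ forall x y, (x, y) \in L -> x \in A /\ y \in A,
      forall x y, x \in A -> y \in A -> (x, y) \in L \/ (y, x) \in L,
      forall x y, (x, y) \in L -> (y, x) \in L -> x = y,
      forall x y z, (x, y) \in L -> (y, z) \in L -> (x, z) \in L &
      forall x y, x \in A -> y \in A -> R x y -> (x, y) \in L]
  (L \in linext A).
Proof.
rewrite inE; apply: (iffP and5P) => -[h1 h2 h3 h4 h5]; split.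
- by move=> x y /(subsetP h1); rewrite inE => /andP.
- by move=> x y xA yA; apply/orP; move/forall_inP/(_ x xA)/forall_inP: h2; apply.
- move=> x y xy yx; apply/eqP; move/forallP/(_ x)/forallP/(_ y): h3.
  by rewrite xy yx.
- move=> x y z xy yz; move/forallP/(_ x)/forallP/(_ y)/forallP/(_ z): h4.
  by rewrite xy yz.
- move=> x y xA yA; apply/implyP.
  by move/forall_inP/(_ x xA)/forall_inP: h5; apply.
- by apply/subsetP => -[x y] /h1[xA yA]; rewrite inE xA.
- by do 2![apply/forall_inP => ? ?]; apply/orP; apply: h2.
- by do 2![apply/forallP => ?]; apply/implyP => /andP[? ?]; apply/eqP; apply: h3.
- by do 3![apply/forallP => ?]; apply/implyP => /andP[]; apply: h4.
- by do 2![apply/forall_inP => ? ?]; apply/implyP; apply: h5.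
Qed.

Definition top_linext A w := [set L in linext A | [forall x in A, (x, w) \in L]].

(** Restriction to [A :\ w] is inverted by putting [w] on top; maximality of [w] keeps the result an
    extension of [R]. *)
Lemma card_top_linext A w :
  w \in A -> (forall y, y \in A -> R w y -> y = w) ->
  #|top_linext A w| = #|linext (A :\ w)|.
Proof.
move=> wA wmax; pose F L := L :|: setX A [set w].
have Fin L x y : ((x, y) \in F L) = ((x, y) \in L) || ((x \in A) && (y == w)).
  by rewrite !inE.
have now L x y : L \in linext (A :\ w) -> (x, y) \in L ->
    [/\ x != w, y != w, x \in A & y \in A].
  by case/linextP => h _ _ _ _ /h; rewrite !inE => -[/andP[-> ->] /andP[-> ->]].
rewrite -[RHS](card_in_imset (f := F)); last first.
  move=> L1 L2 L1w L2w eqF; apply/setP => -[x y].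
  have := Fin L1 x y; rewrite eqF Fin; have [->|yw] := eqVneq y w; last first.
    by rewrite andbF !orbF.
  move=> _; apply/idP/idP => /now; first by case/(_ L1w); rewrite eqxx.
  by case/(_ L2w); rewrite eqxx.
apply: eq_card => L; apply/idP/imsetP => [|[L' L'w ->]].
  rewrite inE => /andP[/linextP[h1 h2 h3 h4 h5] /forall_inP Lw].
  exists (L :&: setX (A :\ w) (A :\ w)).
    apply/linextP; split=> [x y|x y|x y|x y z|x y].
    - by rewrite !inE => /and3P[_ /andP[-> ->] /andP[-> ->]].
    - rewrite !inE => /andP[xw xA] /andP[yw yA]; rewrite /= xw xA yw yA !andbT.
      exact: h2.
    - by rewrite !inE => /andP[xy _] /andP[yx _]; apply: h3.
    - rewrite !inE /= => /andP[xy /andP[-> _]] /andP[yz /andP[_ ->]].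
      by rewrite (h4 _ _ _ xy yz).
    - rewrite !inE /= => /andP[-> xA] /andP[-> yA] /h5; rewrite xA yA.
      by move=> ->.
  apply/setP => -[x y]; rewrite Fin !inE /=.
  apply/idP/orP => [xy|[/andP[]//|/andP[xA /eqP->]]]; last exact: Lw.
  have [xA yA] := h1 _ _ xy; have [yw|yw] := eqVneq y w; first by right; apply/andP.
  left; rewrite xy xA yA !andbT /=; apply: contraNneq yw => xw; apply/eqP.
  by apply: h3 (Lw _ yA) _; rewrite -xw.
rewrite inE; apply/andP; split; last first.
  by apply/forall_inP => x xA; rewrite Fin xA eqxx orbT.
case/linextP: (L'w) => h1 h2 h3 h4 h5; apply/linextP; split=> [x y|x y|x y|x y z|x y].
- by rewrite Fin => /orP[/(now _ _ _ L'w)[]//|/andP[-> /eqP->]].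
- move=> xA yA; rewrite !Fin xA yA /=.
  have [->|yw] := eqVneq y w; first by left; rewrite orbT.
  have [->|xw] := eqVneq x w; first by right; rewrite orbT.
  by rewrite !orbF; apply: h2; rewrite !inE ?xw ?yw.
- rewrite !Fin => /orP[xy|/andP[_ /eqP->]] /orP[yx|/andP[_ /eqP]].
  + exact: h3.
  + by move=> xw; case: (now _ _ _ L'w xy); rewrite xw eqxx.
  + by case: (now _ _ _ L'w yx); rewrite eqxx.
  + by [].
- rewrite !Fin => /orP[xy|/andP[xA /eqP->]] /orP[yz|/andP[yA /eqP->]].
  + by rewrite (h4 _ _ _ xy yz).
  + by case: (now _ _ _ L'w xy) => _ _ -> _; rewrite eqxx orbT.
  + by case: (now _ _ _ L'w yz); rewrite eqxx.
  + by rewrite xA eqxx orbT.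
- move=> xA yA xy; rewrite Fin xA /=; have [|yw] := eqVneq y w; first by rewrite orbT.
  rewrite orbF; apply: h5 => //; rewrite !inE ?yw // xA andbT.
  by apply: contraNneq yw => xw; apply/eqP/wmax => //; rewrite -xw.
Qed.

Lemma card_linext0 : #|linext set0| = 1.
Proof.
rewrite (_ : linext set0 = [set set0]) ?cards1 //; apply/setP => L.
rewrite [RHS]inE; apply/linextP/eqP => [[h _ _ _ _]|->].
  by apply/setP => -[x y]; rewrite inE; apply/negP => /h[]; rewrite inE.
by split=> [x y|x y|x y|x y z|x y]; rewrite inE.
Qed.

Lemma card_linext_max A z :
  z \in A -> (forall x, x \in A -> R x z) -> (forall y, y \in A -> R z y -> y = z) ->
  #|linext A| = #|linext (A :\ z)|.
Proof.
move=> zA zub zmax; rewrite -card_top_linext //; apply: eq_card => L.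
rewrite [RHS]inE; have [/linextP[_ _ _ _ h]|//] := boolP (L \in linext A).
by apply/esym/forall_inP => x xA; apply: h => //; apply: zub.
Qed.

(** Everything but [w] lies below [z], so the last element of a linear extension is [z] or [w], and
    the two cases exclude each other. *)
Lemma card_linext_max2 A z w :
  z \in A -> w \in A -> z != w -> (forall x, x \in A -> x != w -> R x z) ->
  (forall y, y \in A -> R z y -> y = z) -> (forall y, y \in A -> R w y -> y = w) ->
  #|linext A| = #|linext (A :\ z)| + #|linext (A :\ w)|.
Proof.
move=> zA wA zw zub zmax wmax; rewrite -!card_top_linext // -cardsUI.
have topE v L :
    (L \in top_linext A v) = (L \in linext A) && [forall x in A, (x, v) \in L].
  by rewrite inE.
have -> : top_linext A z :&: top_linext A w = set0.
  apply/setP => L; rewrite in_setI in_set0 !topE; apply: contraNF zw.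
  case/andP => /andP[/linextP[_ _ h _ _] /forall_inP Lz] /andP[_ /forall_inP Lw].
  by apply/eqP; apply: h; [apply: Lw|apply: Lz].
rewrite cards0 addn0; apply: eq_card => L; rewrite in_setU !topE -andb_orr.
have [/linextP[_ h2 _ h4 h5]|//] := boolP (L \in linext A).
have ubz x : x \in A -> x != w -> (x, z) \in L by move=> xA xw; apply: h5 => //; apply: zub.
apply/esym/orP; have [wz|zw'] := h2 _ _ wA zA; [left|right]; apply/forall_inP => x xA.
  by have [->|xw] := eqVneq x w; last exact: ubz.
have [->|xw] := eqVneq x w; first by case: (h2 _ _ wA wA).
exact: h4 (ubz _ xA xw) zw'.
Qed.
End LinearExtensionsOn.

Lemma ext_linext n (P : rel 'I_n) : ext P = #|linext P [set: 'I_n]|.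
Proof.
apply: eq_card => L; rewrite inE; apply/idP/linextP.
  case/andP => /andP[/and3P[/forallP h1 /forallP h2 /forallP h3] /forallP h4] /forallP h5.
  split=> [x y|x y _ _|x y xy yx|x y z xy yz|x y _ _ xy].
  - by rewrite !inE.
  - by apply/orP; have /forallP := h4 x; apply.
  - by apply/eqP; have /forallP/(_ y)/implyP := h2 x; apply; rewrite xy.
  - by have /forallP/(_ y)/forallP/(_ z)/implyP := h3 x; apply; rewrite xy.
  - by have /forallP/(_ y)/implyP := h5 x; apply.
case=> h1 h2 h3 h4 h5; apply/andP; split; last first.
  by do 2![apply/forallP => ?]; apply/implyP; apply: h5; rewrite inE.
apply/andP; split; last first.
  by do 2![apply/forallP => ?]; apply/orP; apply: h2; rewrite inE.
apply/and3P; split.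
- by apply/forallP => x; case: (h2 x x); rewrite ?inE.
- by do 2![apply/forallP => ?]; apply/implyP => /andP[? ?]; apply/eqP; apply: h3.
- by do 3![apply/forallP => ?]; apply/implyP => /andP[]; apply: h4.
Qed.

(** * Posets built one element at a time *)

(* The three ways to add an element: above everything, or above everything but
   the distinguished (free) element, which is then kept or replaced by the new one. *)
Variant op := New | Keep | Switch.

Section Word.
Variable g : nat -> op.

(* The free element among 0, .., i - 1; the value at i = 0 is junk, which is why
   words are required to start with New. *)
Fixpoint free_elt (i : nat) : nat :=
  if i is j.+1 then (if g j is Keep then free_elt j else j) else 0.

Fixpoint counts (i : nat) : nat * nat :=
  if i is j.+1 then
    let: (x, y) := counts j in
    match g j with New => (x, x) | Keep => (x + y, y) | Switch => (x + y, x) end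
  else (1, 1).

Definition new_at i := if g i is New then true else false.

Definition word_rel (i j : nat) : bool :=
  (i == j) || (i < j) && (new_at j || (i != free_elt j)).

Lemma free_elt_lt i : 0 < i -> free_elt i < i.
Proof.
elim: i => // i IHi _ /=; case: (g i) => //; rewrite ltnS.
by case: i IHi => // i /(_ isT)/ltnW.
Qed.

(** [New] and [Switch] make the added element free, so every step strictly between [free_elt i] and
    [i] is a [Keep]. *)
Lemma free_elt_free i j : free_elt i < j -> j < i ->
  ~~ new_at j /\ free_elt j = free_elt i.
Proof.
elim: i => // i IHi; rewrite [free_elt i.+1]/= /new_at ltnS; case gi: (g i) => h1 h2.
- by move: h1; rewrite ltnNge h2.
- have [ji|->] : j < i \/ j = i by lia.
    exact: IHi.
  by rewrite gi.
- by move: h1; rewrite ltnNge h2.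
Qed.

(** For [i < j < l] this could fail only if [i] is free when [l] is added; but then [i] was already
    free when [j] was added, so [i] is not below [j]. *)
Lemma word_rel_trans : transitive word_rel.
Proof.
move=> j i l /orP[/eqP->//|/andP[ij hj]] /orP[/eqP<-|/andP[jl hl]].
  by rewrite /word_rel ij hj orbT.
rewrite /word_rel (ltn_trans ij jl) /=; apply/orP; right.
case: (boolP (new_at l)) hl => //= nl hl; apply: contraNneq hl => il.
have [nj fj] : ~~ new_at j /\ free_elt j = free_elt l.
  by apply: free_elt_free => //; rewrite -il.
by move: hj; rewrite (negbTE nj) /= fj -il eqxx.
Qed.

Lemma word_rel_le i j : word_rel i j -> i <= j.
Proof. by case/orP => [/eqP->//|/andP[/ltnW]]. Qed.

Lemma word_rel_poset n : is_poset (fun x y : 'I_n => word_rel x y).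
Proof.
apply/and3P; split.
- by apply/forallP => x; rewrite /word_rel eqxx.
- do 2![apply/forallP => ?]; apply/implyP => /andP[/word_rel_le xy /word_rel_le yx].
  by apply/eqP/val_inj/eqP; rewrite eqn_leq xy.
- by do 3![apply/forallP => ?]; apply/implyP => /andP[]; apply: word_rel_trans.
Qed.

Lemma counts_linext n i : new_at 0 -> i <= n ->
  #|linext (fun x y : 'I_n => word_rel x y) [set x : 'I_n | x < i]| = (counts i).1 /\
  (0 < i ->
   #|linext (fun x y : 'I_n => word_rel x y)
       [set x : 'I_n | (x < i) && (x != free_elt i :> nat)]| = (counts i).2).
Proof.
set R := fun x y : 'I_n => word_rel x y.
move=> g0; elim: i => [|i IHi] lein.
  split=> //=; rewrite (_ : [set x : 'I_n | x < 0] = set0) ?card_linext0 //.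
have {IHi} [IHx IHy] := IHi (ltnW lein); pose z := Ordinal lein.
have setz (x : 'I_n) : (x == z) = (x == i :> nat) by [].
have zmax (A : {set 'I_n}) : {subset A <= [set x : 'I_n | x < i.+1]} ->
    forall y, y \in A -> R z y -> y = z.
  move=> sA y /sA; rewrite inE ltnS => yi /word_rel_le /= iy.
  by apply/val_inj/eqP; rewrite eqn_leq yi.
have Bz : [set x : 'I_n | x < i.+1] :\ z = [set x : 'I_n | x < i].
  by apply/setP => x; rewrite !inE setz; lia.
case gi: (new_at i).
  have -> : counts i.+1 = ((counts i).1, (counts i).1).
    by move: gi; rewrite /new_at /=; case: (counts i) => x y; case: (g i).
  have -> : free_elt i.+1 = i by move: gi; rewrite /new_at /=; case: (g i).
  have -> : [set x : 'I_n | (x < i.+1) && (x != i :> nat)] = [set x : 'I_n | x < i].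
    by apply/setP => x; rewrite !inE; lia.
  split=> //; rewrite (@card_linext_max _ R _ z) ?Bz ?inE //=; last exact: zmax.
  by move=> x; rewrite inE /R /word_rel gi /=; lia.
have i0 : 0 < i by case: (i) gi => //; rewrite g0.
have fi := free_elt_lt i0; have fn : free_elt i < n by apply: leq_trans fi (ltnW lein).
pose w := Ordinal fn; have {}IHy := IHy i0.
have setw (x : 'I_n) : (x == w) = (x == free_elt i :> nat) by [].
(* Once [w] is removed, [z] is the greatest element and can be deleted as well. *)
have Bw : #|linext R ([set x : 'I_n | x < i.+1] :\ w)| = (counts i).2.
  rewrite -IHy (@card_linext_max _ R _ z).
  - by congr #|linext R _|; apply/setP => x; rewrite !inE setw setz; lia.
  - by rewrite !inE setw /=; lia.
  - by move=> x; rewrite !inE setw /R /word_rel /=; lia.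
  - by apply: zmax => x; rewrite !inE => /andP[].
have BB : #|linext R [set x : 'I_n | x < i.+1]| = (counts i).1 + (counts i).2.
  rewrite (@card_linext_max2 _ R _ z w) ?Bz ?Bw ?IHx ?inE //=.
  - lia.
  - by rewrite setw /=; lia.
  - by move=> x; rewrite !inE setw /R /word_rel /=; lia.
  - exact: zmax.
  - move=> y; rewrite inE ltnS => yi /orP[/eqP h|/andP[/= h1 h2]]; first exact/val_inj.
    have [yE|yi'] : y = i :> nat \/ y < i by lia.
      by move: h2; rewrite yE gi eqxx.
    by have [/negbTE ny fy] := free_elt_free h1 yi'; move: h2; rewrite ny fy eqxx.
have CE v : [set x : 'I_n | (x < i.+1) && (x != v :> 'I_n)] = [set x : 'I_n | x < i.+1] :\ v.
  by apply/setP => x; rewrite !inE andbC.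
move: gi; rewrite BB /new_at /=; case: (counts i) IHx Bw {BB IHy} => x y /= IHx Bw.
case: (g i) => //= _; split=> // _.
  by rewrite -Bw -CE.
by rewrite -IHx -Bz -CE.
Qed.

Lemma ext_word_rel n : new_at 0 -> ext (fun x y : 'I_n => word_rel x y) = (counts n).1.
Proof.
move=> g0; have [<- _] := counts_linext g0 (leqnn n).
rewrite ext_linext; congr #|linext _ _|.
by apply/setP => x; rewrite !inE ltn_ord.
Qed.

End Word.

(** * The Euclidean algorithm backwards *)

Definition reach (n x y : nat) : Prop :=
  0 < n /\ exists g, new_at g 0 /\ counts g n = (x, y).

Lemma eq_counts g h n : (forall i, i < n -> g i = h i) -> counts g n = counts h n.
Proof.
elim: n => //= n IHn eqgh; rewrite eqgh // IHn // => i lin.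
exact: eqgh (ltnW lin).
Qed.

Lemma reach_ext n x y : reach n x y -> exists P : rel 'I_n, is_poset P /\ ext P = x.
Proof.
case=> _ [g [g0 gn]]; exists (fun i j : 'I_n => word_rel g i j).
by rewrite word_rel_poset ext_word_rel // gn.
Qed.

Lemma reach_op n x y o : reach n x y ->
  reach n.+1 (if o is New then x else x + y) (if o is Keep then y else x).
Proof.
case=> n0 [g [g0 gn]]; split=> //.
exists (fun i => if i == n then o else g i); split.
  (* As [0 < n], the appended operation is not the initial one, which has to stay [New]. *)
  by rewrite /new_at eq_sym (gtn_eqF n0).
rewrite /= eqxx (@eq_counts _ g) ?gn; first by case: o.
by move=> i; case: eqP => // ->; rewrite ltnn.
Qed.

Lemma reach1 : reach 1 1 1.
Proof. by split=> //; exists (fun=> New). Qed.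

Lemma reach_pad n m x y : n <= m -> reach n x y -> exists y', reach m x y'.
Proof.
move/subnKC <-; elim: (m - n) => [|d IHd] r; first by exists y; rewrite addn0.
by have [y' /(@reach_op _ _ _ New) r'] := IHd r; exists x; rewrite addnS.
Qed.

(** The partner [y] of the gcd can be left arbitrary because the constructions below all start with
    a [New], which discards it. *)
Definition cost (s a b : nat) : Prop :=
  forall n y, reach n (gcdn a b) y -> reach (n + s) a b.

Lemma cost_refl a : cost 1 a a.
Proof. by move=> n y; rewrite gcdnn addn1 => /(@reach_op _ _ _ New). Qed.

Lemma cost_keep j s a b : cost s a b -> cost (s + j) (j * b + a) b.
Proof.
move=> h n y; rewrite gcdnC gcdnMDl gcdnC => /h; elim: j => [|j IHj] r; first by rewrite addn0.
have /(@reach_op _ _ _ Keep) := IHj r.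
by rewrite !addnS mulSn addnAC [b + _]addnC.
Qed.

Lemma cost_switch s a b : cost s a b -> cost s.+1 (a + b) a.
Proof. by move=> h n y; rewrite gcdnC gcdnDl addnS => /h/(@reach_op _ _ _ Switch). Qed.

Lemma cost_mul j b : 0 < j -> cost j (j * b) b.
Proof.
case: j => // j _; rewrite mulSn addnC -add1n; exact/cost_keep/cost_refl.
Qed.

(** One [Switch] and then [j - 1] times [Keep]: (b, r), (b + r, b), ..., (j b + r, b). *)
Lemma cost_euclid j s b r : 0 < j -> cost s b r -> cost (s + j) (j * b + r) b.
Proof.
case: j => // j _ /cost_switch/(@cost_keep j).
by rewrite addnS -addSn mulSn addnCA addnA.
Qed.

Lemma reach_self n : 0 < n -> reach n n 1.
Proof.
case: n => // n _; elim: n => [|n IHn]; first exact: reach1.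
by have /(@reach_op _ _ _ Keep) := IHn; rewrite addn1.
Qed.

(** * Partial quotients on average *)

Lemma leq_sum_nat m n (F G : nat -> nat) :
  (forall i, m <= i < n -> F i <= G i) ->
  \sum_(m <= i < n) F i <= \sum_(m <= i < n) G i.
Proof. by move=> le; rewrite big_nat [leqRHS]big_nat; apply: leq_sum. Qed.

Lemma eq_modM_coprime d q a b : coprime d q -> a * q = b * q %[mod d] -> a = b %[mod d].
Proof.
move=> cop; wlog le_ba : a b / b <= a.
  by move=> H; case/orP: (leq_total a b) => le e; [apply/esym/H|apply: H].
move/eqP; rewrite eqn_mod_dvd ?leq_mul2r ?le_ba ?orbT // -mulnBl Gauss_dvdl //.
by rewrite -eqn_mod_dvd // => /eqP.
Qed.

Lemma mulB_inj g a b c d : 0 < a -> 0 < b -> c < g -> d < g ->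
  a * g - c = b * g - d -> a = b /\ c = d.
Proof.
move=> a0 b0 cg dg e; have ag : g <= a * g by rewrite leq_pmull.
have bg : g <= b * g by rewrite leq_pmull.
have [ab|ba|ab] := ltngtP a b; last by split=> //; subst b; lia.
  by have : a.+1 * g <= b * g; [rewrite leq_mul2r ab orbT|rewrite mulSn; lia].
by have : b.+1 * g <= a * g; [rewrite leq_mul2r ba orbT|rewrite mulSn; lia].
Qed.

(** Each of the [l] dyadic blocks [2^i, 2^(i+1)) contributes at most [x]. *)
Lemma leq_sum_divn_dyadic x l : \sum_(1 <= q < 2 ^ l) x %/ q <= x * l.
Proof.
elim: l => [|l IHl]; first by rewrite big_geq.
rewrite (@big_cat_nat _ _ _ (2 ^ l)) ?expn_gt0 ?leq_exp2l //= mulnS addnC leq_add //.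
apply: (@leq_trans (\sum_(2 ^ l <= q < 2 ^ l.+1) x %/ 2 ^ l)).
  apply: leq_sum_nat => q /andP[lq _].
  by apply: leq_div2l; rewrite ?expn_gt0.
rewrite sum_nat_const_nat expnS mul2n -addnn addnK mulnC.
exact: leq_trunc_div.
Qed.

(* With g = gcd(q, k), the residues m q are multiples g a of g, each one hit for g
   values of m; these are told apart by i = m %/ (k / g) < g, and m |-> g a - i is
   an injection into [1, r]. *)
Lemma card_small_residues k q r : #|[set m : 'I_k | 0 < m * q %% k <= r]| <= r.
Proof.
have [k0|k_gt0] := posnP k.
  by rewrite eq_card0 // => -[m]; rewrite k0.
pose g := gcdn q k; have g_gt0 : 0 < g by rewrite gcdn_gt0 k_gt0 orbT.
pose k' := k %/ g; pose q' := q %/ g.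
have kE : k = k' * g by rewrite divnK ?dvdn_gcdr.
have qE : q = q' * g by rewrite divnK ?dvdn_gcdl.
have k'_gt0 : 0 < k' by move: k_gt0; rewrite kE muln_gt0 => /andP[].
have cop : coprime k' q'.
  by rewrite coprime_sym /coprime -(eqn_pmul2r g_gt0) mul1n muln_gcdl -kE -qE.
have rhoE (m : 'I_k) : m * q %% k = (m * q' %% k') * g.
  by rewrite {1}qE {2}kE mulnA muln_modl.
pose f (m : 'I_k) := (m * q' %% k') * g - m %/ k'.
have ltg (m : 'I_k) : m %/ k' < g by rewrite ltn_divLR // mulnC -kE.
have finj : {in [set m : 'I_k | 0 < m * q %% k <= r] &, injective f}.
  move=> m1 m2; rewrite !inE !rhoE !muln_gt0 => /andP[/andP[h1 _] _] /andP[/andP[h2 _] _].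
  case/(mulB_inj h1 h2 (ltg m1) (ltg m2)) => /(eq_modM_coprime cop) e1 e2.
  by apply: val_inj => /=; rewrite (divn_eq m1 k') (divn_eq m2 k') e1 e2.
rewrite cardE -(size_map f) -[r in leqRHS](size_iota 1); apply: uniq_leq_size.
  rewrite map_inj_in_uniq ?enum_uniq // => m1 m2; rewrite !mem_enum; exact: finj.
move=> _ /mapP[m + ->]; rewrite mem_enum inE rhoE mem_iota muln_gt0 => /andP[/andP[h _] hr].
have gh : g <= m * q' %% k' * g by rewrite leq_pmull.
rewrite /f; move: gh hr (ltg m).
by move: (_ %% _ * g) (_ %/ _) => u v; lia.
Qed.

(* m / k has a reduced denominator e = k / gcd(m, k) with 4 e^2 < k, and there are
   at most E^2 fractions in [0, 1) of denominator at most E. *)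
Lemma card_big_gcd k : 4 * #|[set m : 'I_k | 4 * k < gcdn m k ^ 2]| <= k.
Proof.
have [k0|k_gt0] := posnP k.
  by rewrite eq_card0 // => -[m]; rewrite k0.
set B := [set m | _]; pose e (m : 'I_k) := k %/ gcdn m k.
have [->|/set0Pn[m0 m0B]] := eqVneq B set0; first by rewrite cards0.
have [m1 m1B eE] : {m | m \in B & \max_(m in B) e m = e m}.
  by apply: eq_bigmax_cond; apply/card_gt0P; exists m0.
set E := \max_(m in B) e m in eE.
have g_gt0 (m : 'I_k) : 0 < gcdn m k by rewrite gcdn_gt0 k_gt0 orbT.
have eg (m : 'I_k) : e m * gcdn m k = k by rewrite divnK ?dvdn_gcdr.
have e_gt0 (m : 'I_k) : 0 < e m by move: k_gt0; rewrite -{1}(eg m) muln_gt0 => /andP[].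
have leE m : m \in B -> e m <= E by move=> mB; apply: leq_bigmax_cond.
have E4 : 4 * E ^ 2 < k.
  move: m1B; rewrite eE inE -(ltn_pmul2l (_ : 0 < e m1 ^ 2)) ?expn_gt0 ?e_gt0 //.
  by rewrite -expnMn eg; nia.
have E_gt0 : 0 < E by rewrite eE.
(* The reduced fraction m / k, as (denominator - 1, numerator). *)
pose f (m : 'I_k) : 'I_E.-1.+1 * 'I_E.-1.+1 := (inord (e m).-1, inord (m %/ gcdn m k)).
have finj : {in B &, injective f}.
  move=> m m' mB m'B [/(congr1 val) + /(congr1 val)].
  have ltE (x : 'I_k) : x \in B -> (e x).-1 < E.-1.+1 /\ x %/ gcdn x k < E.-1.+1.
    move=> xB; have := leE x xB; have := e_gt0 x.
    have : x %/ gcdn x k < e x.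
      by rewrite ltn_divLR ?g_gt0 // eg.
    lia.
  case: (ltE m mB) => a1 a2; case: (ltE m' m'B) => b1 b2.
  rewrite /= !inordK // => e1 e2; apply: val_inj => /=.
  have ee : e m = e m' by have := e_gt0 m; have := e_gt0 m'; lia.
  have gg : gcdn m k = gcdn m' k.
    by apply/eqP; rewrite -(eqn_pmul2l (e_gt0 m)) eg ee eg.
  by rewrite -(divnK (dvdn_gcdl m k)) e2 gg divnK ?dvdn_gcdl.
have := max_card (mem (f @: B)); rewrite card_in_imset // card_prod card_ord prednK //.
lia.
Qed.

Lemma markov_count (T : finType) (N : T -> nat) c :
  c.+1 * #|[set m | c < N m]| <= \sum_m N m.
Proof.
rewrite (bigID (mem [set m | c < N m])) /= -[X in X <= _]addn0 leq_add // mulnC.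
rewrite -sum_nat_const; apply: leq_sum => m; by rewrite inE.
Qed.

(* m k.-1 stands for - m modulo k. *)
Definition hit (k m x j : nat) : bool :=
  (0 < m * x %% k) && (x * j * (m * x %% k) <= k) ||
  (0 < m * k.-1 * x %% k) && (x * j * (m * k.-1 * x %% k) <= k).

(** Two uses of [card_small_residues], for the multipliers [x] and [k.-1 * x], with
    [r = k %/ (x * j)]. *)
Lemma sum_hit k x j : 0 < x -> 0 < j ->
  \sum_(m < k) hit k m x j <= 2 * (k %/ (x * j)).
Proof.
move=> x0 j0; have xj0 : 0 < x * j by rewrite muln_gt0 x0.
have h y : \sum_(m < k) ((0 < m * y %% k) && (x * j * (m * y %% k) <= k)) <= k %/ (x * j).
  apply: leq_trans (card_small_residues k y _).
  rewrite -sum1dep_card [leqRHS]big_mkcond; apply: leq_sum => m _.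
  by rewrite leq_divRL // [_ * (x * j)]mulnC; case: ifP => //; case: (_ && _).
rewrite mul2n -addnn; apply: leq_trans (leq_add (h x) (h (k.-1 * x))).
rewrite -big_split; apply: leq_sum => m _ /=.
by rewrite /hit mulnA; do 2!case: (_ && _).
Qed.

Lemma sum_hit_dyadic k l j : 0 < j ->
  \sum_(m < k) \sum_(1 <= x < 2 ^ l) hit k m x j <= 2 * l * (k %/ j).
Proof.
move=> j0; rewrite exchange_big /=.
apply: (@leq_trans (\sum_(1 <= x < 2 ^ l) 2 * (k %/ j %/ x))).
  apply: leq_sum_nat => x /andP[x0 _].
  by rewrite -divnMA [j * x]mulnC; apply: sum_hit.
by rewrite -big_distrr -mulnA leq_mul2l /= [l * _]mulnC leq_sum_divn_dyadic.
Qed.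

(** A union bound: [N1] has mean at most 2 l / 2^t <= 1/8 and [N2] at most 2 t l, so by Markov the
    exceptional sets [B0], [B1], [B2] have proportions at most 1/4, 1/8, 1/8. *)
Lemma exists_good_residue k l t : 4 < k -> 0 < l -> 16 * l <= 2 ^ t ->
  exists m, [/\ 0 < m < k, gcdn m k ^ 2 <= 4 * k,
    forall x, 0 < x < 2 ^ l -> hit k m x (2 ^ t) = false &
    \sum_(1 <= x < 2 ^ l) \sum_(1 <= j < 2 ^ t) hit k m x j <= 16 * (t * l)].
Proof.
move=> k4 l0 lt; have t0 : 0 < t by case: t lt => //; rewrite expn0; lia.
pose N1 (m : 'I_k) := \sum_(1 <= x < 2 ^ l) hit k m x (2 ^ t).
pose N2 (m : 'I_k) := \sum_(1 <= x < 2 ^ l) \sum_(1 <= j < 2 ^ t) hit k m x j.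
pose B0 := [set m : 'I_k | 4 * k < gcdn m k ^ 2].
pose B1 := [set m | 0 < N1 m]; pose B2 := [set m | 16 * (t * l) < N2 m].
have h0 : 4 * #|B0| <= k := card_big_gcd k.
have h1 : 8 * #|B1| <= k.
  have := leq_trans (markov_count N1 0) (sum_hit_dyadic k l (expn_gt0 2 t)).
  rewrite mul1n -/B1 => le; have := leq_trunc_div k (2 ^ t); nia.
have h2 : 8 * #|B2| <= k.
  have le : \sum_m N2 m <= 2 * l * (k * t).
    under eq_bigr do rewrite /N2 exchange_big /=.
    rewrite exchange_big /=.
    apply: leq_trans (leq_sum_nat (G := fun j => 2 * l * (k %/ j)) _) _.
      by move=> j /andP[j0 _]; apply: sum_hit_dyadic.
    by rewrite -big_distrr leq_mul2l leq_sum_divn_dyadic orbT.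
  have := leq_trans (markov_count N2 (16 * (t * l))) le; rewrite -/B2.
  have : 0 < t * l by rewrite muln_gt0 t0.
  rewrite (_ : 2 * l * (k * t) = 2 * k * (t * l)); last by lia.
  move: (t * l) #|B2| => p b; nia.
have [m mB] : exists m, m \notin B0 :|: B1 :|: B2.
  apply/existsP; rewrite -negb_forall; apply/negP => /forallP all.
  have : k <= #|B0 :|: B1 :|: B2|.
    by rewrite -[k in leqLHS]card_ord; apply/subset_leq_card/subsetP.
  have := (leq_card_setU (B0 :|: B1) B2).1; have := (leq_card_setU B0 B1).1; lia.
move: mB; rewrite !inE !negb_or -!leqNgt leqn0 => /andP[/andP[g /eqP z] n2].
exists m; split=> //.
(* m = 0 is excluded by the gcd bound: gcd(0, k) = k and k^2 > 4 k. *)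
- rewrite ltn_ord andbT lt0n; apply: contraTneq g => ->.
  by rewrite gcd0n -ltnNge; nia.
- move=> x xl; apply/negP => hx; have : 0 < N1 m; last by rewrite z.
  by rewrite /N1 (big_rem x) ?mem_index_iota //= hx.
Qed.

(** * Cost of one run of the Euclidean algorithm *)

Section EuclidRun.
Variables (k l t : nat) (H : nat -> nat -> bool).
Hypothesis k_lt : k < 2 ^ l.
Hypothesis H_top : forall x, 0 < x < 2 ^ l -> H x (2 ^ t) = false.

Let weight x := \sum_(1 <= j < 2 ^ t) H x j.

(** With [H := hit k m] this holds for both [m] and [m * k.-1], the multipliers that alternate
    during the run. *)
Definition sees u := forall x j, 0 < u * x %% k -> x * j * (u * x %% k) <= k -> H x j.

(** Modulo [k], u q = - v q = b. Since q a <= k, each j <= a / b satisfies q j b <= k and so gives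
    [H q j]; [H_top] forces a / b < 2^t, so all these j are counted by [weight q]. *)
Lemma leq_quotient_weight a b q q' u v :
  0 < b -> b < k -> b <= a -> 0 < q -> q * a + q' * b = k ->
  k %| u + v -> k %| v * q + b -> sees u -> a %/ b <= weight q.
Proof.
move=> b0 bk ba q0 kE /dvdnP[c cE] /dvdnP[d dE] su.
have uq : u * q %% k = b.
  have e : d * k + u * q = c * q * k + b.
    have : (u + v) * q = c * k * q by rewrite cE.
    by rewrite -dE; lia.
  by rewrite -(modnMDl d) e modnMDl modn_small.
have Hq j : j <= a %/ b -> H q j.
  rewrite leq_divRL // => jb; apply: su; rewrite uq // -mulnA; nia.
have qt : 0 < q < 2 ^ l by rewrite q0 /= (leq_ltn_trans _ k_lt) //; nia.
have ab : a %/ b < 2 ^ t by rewrite ltnNge; apply/negP => /Hq; rewrite H_top.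
rewrite /weight (@big_cat_nat _ _ _ (a %/ b).+1) //=; apply: leq_trans (leq_addr _ _).
rewrite -[leqLHS](_ : \sum_(1 <= j < (a %/ b).+1) 1 = _); last first.
  by rewrite sum_nat_const_nat muln1 subn1.
by apply: leq_sum_nat => j /andP[_ jab]; rewrite Hq.
Qed.

(** With c = [a %/ b], the new expression is (u q' + a) + c (u q - b), and u q - b is congruent to -
    (v q + b). *)
Lemma dvdn_euclid_step a b q q' u v :
  k %| u + v -> k %| v * q + b -> k %| u * q' + a ->
  k %| u * (a %/ b * q + q') + a %% b.
Proof.
move=> uv vq; move: (divn_eq a b); move: (a %/ b) (a %% b) => c r -> uq'.
rewrite -(@dvdn_addl (c * (v * q + b))) ?dvdn_mull //.
rewrite (_ : _ + _ = (u * q' + (c * b + r)) + (u + v) * (c * q)).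
  by rewrite dvdn_add // dvdn_mulr.
by lia.
Qed.

Lemma euclid_invariant a b q q' :
  (a %/ b * q + q') * b + q * (a %% b) = q * a + q' * b.
Proof. by move: (divn_eq a b); move: (a %/ b) (a %% b) => c r ->; lia. Qed.

(* The parameters follow the Euclidean algorithm on (k, m): a and b are consecutive
   remainders, q' and q the denominators of the corresponding convergents, and u, v
   are m and - m modulo k, exchanged at each step. *)
Lemma euclid_cost b : forall a q q' u v,
  0 < b -> b <= a -> 0 < q -> 0 < q' -> q * a + q' * b = k ->
  k %| u + v -> k %| v * q + b -> k %| u * q' + a -> sees u -> sees v ->
  exists2 s, s <= \sum_(q <= x < 2 ^ l) weight x & cost s a b.
Proof.
have [n] := ubnP b; elim: n b => // n IHn b bn a q q' u v b0 ba q0 q'0 kE uv vq uq su sv.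
have bk : b < k by rewrite -kE; clear -b0 ba q0 q'0; nia.
have ql : q < 2 ^ l.
  by apply: leq_ltn_trans k_lt; rewrite -kE; clear -b0 ba q0 q'0; nia.
have ab0 : 0 < a %/ b by rewrite divn_gt0.
(* Denominators strictly increase since [0 < q'], so each partial quotient is charged to a different
   term of the sum. *)
have qq : q < a %/ b * q + q'.
  by apply: leq_trans (leq_add (leq_pmull q ab0) q'0); rewrite addn1.
have wq := leq_quotient_weight b0 bk ba q0 kE uv vq su.
have [r0|r0] := posnP (a %% b).
  exists (a %/ b); last by rewrite {2}(divn_eq a b) r0 addn0; apply: cost_mul.
  by rewrite big_ltn //; apply: leq_trans wq (leq_addr _ _).
have rb := ltn_pmod a b0.
have [||||||||||s sle sc] := IHn (a %% b) (leq_trans rb bn) b (a %/ b * q + q') q v u => //.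
- exact: ltnW.
- by rewrite addn_gt0 q'0 orbT.
- by rewrite euclid_invariant.
- by rewrite addnC.
- exact: dvdn_euclid_step uv vq uq.
exists (s + a %/ b); last by rewrite {2}(divn_eq a b); apply: cost_euclid.
rewrite big_ltn // addnC leq_add //; apply: leq_trans sle _.
have [le|le] := leqP (a %/ b * q + q') (2 ^ l); last by rewrite big_geq // ltnW.
by rewrite [leqRHS](@big_cat_nat _ _ _ (a %/ b * q + q')) ?leq_addl.
Qed.

(** The first division has q' = 0 and is done separately. The next denominator, k / m, can again be
    1, so [weight 1] may be charged twice; hence the factor 2. *)
Lemma euclid_cost_start m : 0 < m < k -> sees m -> sees (m * k.-1) ->
  exists2 s, s <= 2 * \sum_(1 <= x < 2 ^ l) weight x & cost s k m.
Proof.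
case/andP=> m0 mk sm sm'; set W := \sum_(_ <= x < _) _.
have d1 : k %| m + m * k.-1 by rewrite -mulnS prednK ?dvdn_mull //; lia.
have d2 : k %| m * k.-1 * 1 + m by rewrite muln1 addnC.
have d3 : k %| m * 0 + k by rewrite muln0.
have w1 : k %/ m <= weight 1.
  by apply: (leq_quotient_weight (q' := 0)) d1 d2 sm => //; lia.
have WE : weight 1 <= W by rewrite /W big_ltn ?leq_addr //; lia.
have km0 : 0 < k %/ m by rewrite divn_gt0 // ltnW.
have [r0|r0] := posnP (k %% m).
  exists (k %/ m); first by lia.
  by rewrite {2}(divn_eq k m) r0 addn0; apply: cost_mul.
have rm := ltn_pmod k m0.
have [||||||||||s sle sc] := @euclid_cost (k %% m) m (k %/ m) 1 (m * k.-1) m => //.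
- exact: ltnW.
- by rewrite mul1n -divn_eq.
- by rewrite addnC.
- by have := dvdn_euclid_step d1 d2 d3; rewrite muln1 addn0.
exists (s + k %/ m); last by rewrite {2}(divn_eq k m); apply: cost_euclid.
rewrite mul2n -addnn leq_add //; last exact: leq_trans WE.
apply: leq_trans sle _; rewrite /W.
have [le|le] := leqP (k %/ m) (2 ^ l); last by rewrite big_geq // ltnW.
by rewrite [leqRHS](@big_cat_nat _ _ _ (k %/ m)) ?leq_addl.
Qed.
End EuclidRun.

(** * Recursion on the gcd, and the bound for all k *)

Lemma reach_bound L t : 16 * L <= 2 ^ t -> forall l, l <= L -> forall k, 0 < k < 2 ^ l ->
  exists n y, n <= 128 * (t * l) /\ reach n k y.
Proof.
(* [t] is fixed by the top-level [L]; only [l] decreases in the recursion. *)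
move=> Lt l; have [n] := ubnP l; elim: n l => // n IHn l ln lL k /andP[k0 kl].
have l0 : 0 < l by case: l kl {ln lL}; first by lia.
have t0 : 0 < t by rewrite lt0n; apply: contraTneq Lt => ->; rewrite expn0; lia.
have tl : l <= t * l by rewrite leq_pmull.
have [k32|k32] := ltnP k 32.
  exists k, 1; split; last exact: reach_self.
  by lia.
have l6 : 5 < l.
  by rewrite ltnNge; apply/negP => l5; have := @leq_exp2l 2 l 5 isT; rewrite l5; lia.
have [||m [mk gk Hm Nm]] := @exists_good_residue k l t _ l0; [lia|nia|].
have [||s sle sc] := @euclid_cost_start k l t (hit k m) kl Hm m mk.
- by move=> x j h1 h2; rewrite /hit h1 h2.
- by move=> x j h1 h2; rewrite /hit h1 h2 orbT.
(* gcd^2 <= 4 k < 2^(l+2) <= 2^(2h), and 4 h <= 3 l because l >= 6. *)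
pose h := (l + 3)./2.
have [|||n' [y [n'le r]]] := IHn h _ _ (gcdn k m); try by rewrite /h; lia.
  rewrite gcdn_gt0 k0 /= gcdnC ltnNge; apply/negP => le.
  have := leq_trans (leq_mul le le) gk; rewrite -expnD addnn.
  have : 2 ^ l.+2 <= 2 ^ h.*2 by rewrite leq_exp2l // /h; lia.
  by rewrite !expnS; lia.
(* The run costs at most 2 * 16 t l and the recursion 128 t h <= 96 t l, which add up to 128 t l. *)
exists (n' + s), m; split; last exact: sc r.
have : 4 * h <= 3 * l by rewrite /h; lia.
nia.
Qed.

Lemma ext_bound n l t k : 0 < k < 2 ^ l -> 16 * l <= 2 ^ t -> 128 * (t * l) <= n ->
  exists P : rel 'I_n, is_poset P /\ ext P = k.
Proof.
move=> kl lt tn; have [m [y [mle r]]] := reach_bound lt (leqnn l) kl.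
by have [y' /reach_ext] := reach_pad (leq_trans mle tn) r.
Qed.

(** * Real estimates *)

Open Scope R_scope.

Lemma INR_leq m n : leq m n -> INR m <= INR n.
Proof. by move/leP; apply: le_INR. Qed.

Lemma leq_INR m n : INR m <= INR n -> leq m n.
Proof. by move=> h; apply/leP/INR_le. Qed.

Lemma INR_muln m n : INR (muln m n) = INR m * INR n.
Proof. exact: mult_INR. Qed.

Lemma ln_le_mono x y : 0 < x -> x <= y -> ln x <= ln y.
Proof. by move=> x0 [/(ln_increasing _ _ x0)|->]; lra. Qed.

Lemma ln_INR_exp2 m : INR m / 2 <= ln (INR (expn 2 m)).
Proof.
have -> : INR (expn 2 m) = 2 ^ m.
  by elim: m => [|m IHm] //; rewrite expnS INR_muln IHm.
rewrite ln_pow; last by lra.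
by have := ln_lt_2; have := pos_INR m; nra.
Qed.

Lemma ln_le_2sqrt x : 0 < x -> ln x <= 2 * sqrt x.
Proof.
move=> x0; have s0 := sqrt_lt_R0 _ x0; rewrite -{1}(sqrt_sqrt x); last by lra.
rewrite ln_mult //; have := exp_ineq1_le (ln (sqrt x)); rewrite exp_ln //; lra.
Qed.

Theorem theorem1p1 :
  exists c : R, 0 < c /\
  exists n0 : nat, forall n : nat, leq n0 n ->
    forall k : nat, leq 1 k ->
      INR k <= exp (c * INR n / ln (INR n)) ->
      exists P : rel 'I_n, is_poset P /\ ext P = k.
Proof.
(* 2560 = 128 * 5 * 4: below, t <= 5 ln N and l <= 4 y with y = N / (2560 ln N), so 128 t l <= N. *)
exists (/ 2560); split; first by lra.
exists (muln 2560 2560) => n /INR_leq; rewrite INR_muln => n_ge k k0 hk.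
have e0 : INR 2560 = 2560 by rewrite INR_IZR_INZ.
rewrite {}e0 in n_ge.
set N := INR n in n_ge hk *.
have sN : 2560 <= sqrt N.
  by rewrite -(sqrt_square 2560); [apply: sqrt_le_1_alt|lra].
have lnN := @ln_le_2sqrt N ltac:(lra).
have NE : sqrt N * sqrt N = N by apply: sqrt_sqrt; lra.
have lN1 : 1 <= ln N.
  rewrite -{1}(ln_exp 1); apply: ln_le_mono; first exact: exp_pos.
  by have := exp_le_3; lra.
have l16 : ln 16 <= ln N by apply: ln_le_mono; lra.
set y := / 2560 * N / ln N in hk.
have yE : y * ln N = N / 2560 by rewrite /y; field; lra.
(* The threshold 2560^2 is used here: N / ln N >= sqrt N / 2 >= 1280. It turns l <= 1 + 2 y into l
   <= 4 y. *)
have y1 : 1 <= 2 * y by nra.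
have [l_le l_gt] := andP (trunc_log_bounds (isT : leq 2 2) k0).
set l := (trunc_log 2 k).+1 in l_gt.
have lE : INR l <= 1 + 2 * y.
  rewrite /l S_INR; have := ln_INR_exp2 (trunc_log 2 k).
  have p0 : 0 < INR (expn 2 (trunc_log 2 k)).
    by apply: (lt_INR 0); apply/ltP; rewrite expn_gt0.
  have := ln_le_mono p0 (Rle_trans _ _ _ (INR_leq l_le) hk); rewrite ln_exp; lra.
have l1 : 1 <= INR l by rewrite /l S_INR; have := pos_INR (trunc_log 2 k); lra.
have lN : INR l <= N by nra.
have l16_gt0 : leq 1 (muln 16 l) by rewrite muln_gt0.
have [t_le t_gt] := andP (trunc_log_bounds (isT : leq 2 2) l16_gt0).
set t := (trunc_log 2 (muln 16 l)).+1 in t_gt.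
(* Since ln 2 > 1/2, t <= 1 + 2 ln (16 l), where 1, ln 16 and ln l are each at most ln N. *)
have tE : INR t <= 5 * ln N.
  rewrite /t S_INR; have := ln_INR_exp2 (trunc_log 2 (muln 16 l)).
  have p0 : 0 < INR (expn 2 (trunc_log 2 (muln 16 l))).
    by apply: (lt_INR 0); apply/ltP; rewrite expn_gt0.
  have i16 : INR 16 = 16 by rewrite INR_IZR_INZ.
  have := ln_le_mono p0 (INR_leq t_le); rewrite INR_muln i16 ln_mult; [|lra..].
  have := @ln_le_mono (INR l) N ltac:(lra) lN; lra.
apply: (@ext_bound n l t k); rewrite ?k0 //; first exact: ltnW.
apply: leq_INR; rewrite !INR_muln -/N.
have -> : INR 128 = 128 by rewrite INR_IZR_INZ.
have t0 := pos_INR t.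
have tl : INR t * INR l <= 5 * ln N * (4 * y) by apply: Rmult_le_compat; lra.
nra.
Qed.
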